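(* Let $X$ be a connected Poincaré duality space of dimension $4d$ with class $[X]\in H_{4d}(X;\mathbb{R})$. Let $n=\dim_{\mathbb{R}}H_{2d}(X;\mathbb{R})$ and let $\alpha_1,\dots,\alpha_n$ be a basis of $H_{2d}(X;\mathbb{R})$. Let $\alpha_1^*,\dots,\alpha_n^*$ be the Kronecker dual basis of $H^{2d}(X;\mathbb{R})$, i.e. $\langle\alpha_i^*,\alpha_j\rangle=\delta_{ij}$, and let $\alpha_1^\vee,\dots,\alpha_n^\vee$ be the Poincaré dual basis of $H^{2d}(X;\mathbb{R})$, i.e. $\alpha_i^\vee\cap[X]=\alpha_i$. Then the inverse of the symmetric matrix with $\langle\alpha_i^*\cup\alpha_j^*,[X]\rangle$ as $(i,j)$ entry is the symmetric matrix with $\langle\alpha_i^\vee\cup\alpha_j^\vee,[X]\rangle$ as $(i,j)$ entry.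
   Context: A connected Poincaré duality space of dimension $4d$ is a connected topological space $X$ with a class $[X]\in H_{4d}(X;\mathbb{R})$ such that $H^*(X;\mathbb{R})$ is a finite dimensional vector space and the map $\cap[X]\colon H^q(X;\mathbb{R})\to H_{4d-q}(X;\mathbb{R})$ is an isomorphism for every $q$. $\langle\ ,\ \rangle$ is the Kronecker pairing between cohomology and homology. *)

(* Defs.v *)
From HB Require Import structures.
From mathcomp Require Import freeg.
From mathcomp Require Import all_boot all_order all_algebra generic_quotient ring_quotient.
From mathcomp Require Import mathcomp_extra boolp classical_sets functions reals.
From mathcomp Require Import topology normedtype.
From mathcomp Require Import zify ring.

Set Implicit Arguments.
Unset Strict Implicit.
Unset Printing Implicit Defensive.

Import Order.TTheory GRing.Theory Num.Theory.
Import numFieldNormedType.Exports.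

Local Open Scope classical_set_scope.
Local Open Scope ring_scope.

(* The extension [fglift f] of a map [f] on generators to the free module
   [{freeg K / R}] is linear; multinomials only states additivity. *)
Section FreeModule.
Variables (R : nzRingType) (K : choiceType) (M : lmodType R) (f : K -> M).

HB.instance Definition _ := GRing.isZmodMorphism.Build {freeg K / R} M
  (fglift f) (lift_is_additive f).

Lemma fglift_is_scalable : scalable (fglift f).
Proof.
have fE (r : seq K) (c : K -> R) :
    fglift f (\sum_(z <- r) << c z *g z >>) = \sum_(z <- r) c z *: f z.
  by rewrite raddf_sum; apply: eq_bigr => z _; rewrite -liftU.
move=> k x; rewrite [in LHS]/GRing.scale /= /fgscale fE.
rewrite -[in RHS](freeg_sumE x) fE scaler_sumr.
by apply: eq_bigr => z _; rewrite scalerA.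
Qed.

HB.instance Definition _ :=
  GRing.isScalable.Build R {freeg K / R} M _ (fglift f) fglift_is_scalable.

End FreeModule.

(* For linear maps U --f--> V --g--> W, [homology f g] is ker g modulo im f.
   The composite is not required to vanish: the quotient is by the submodule
   of those elements of ker g that lie in im f. *)
Section Homology.
Variables (R : nzRingType) (U V W : lmodType R).
Variables (f : {linear U -> V}) (g : {linear V -> W}).

Definition ker_pred : {pred V} := [pred v | g v == 0].

Lemma ker_pred_submod : submod_closed ker_pred.
Proof.
split; first by rewrite inE linear0.
by move=> k x y; rewrite !inE linearP => /eqP-> /eqP->; rewrite scaler0 addr0.
Qed.

HB.instance Definition _ :=
  GRing.isSubmodClosed.Build R V ker_pred ker_pred_submod.

Definition cycle : Type := {v : V | v \in ker_pred}.
HB.instance Definition _ := [isSub of cycle for @sval _ _].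
HB.instance Definition _ := [Choice of cycle by <:].
HB.instance Definition _ := [SubChoice_isSubLmodule of cycle by <:].

Definition bnd_pred : {pred cycle} := [pred z | `[< exists u, f u = val z >]].

Lemma bnd_pred_zmod : zmod_closed bnd_pred.
Proof.
split; first by apply/asboolP; exists 0; rewrite linear0.
move=> x y /asboolP[u fu] /asboolP[v fv]; apply/asboolP; exists (u - v).
by rewrite linearB fu fv raddfB.
Qed.

HB.instance Definition _ :=
  GRing.isZmodClosed.Build cycle bnd_pred bnd_pred_zmod.

Definition homology : Type := Quotient.quot bnd_pred.
HB.instance Definition _ := GRing.Zmodule.on homology.
HB.instance Definition _ := Quotient.on homology.
HB.instance Definition _ : EqQuotient cycle (Quotient.equiv bnd_pred) homology :=
  EqQuotient.on homology.

Definition hclass (z : cycle) : homology := \pi_homology%qT z.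

Lemma hclassP z z' :
  hclass z = hclass z' <-> exists u, f u = val z - val z'.
Proof.
split=> [/eqP|[u fu]].
  by rewrite /hclass -Quotient.idealrBE => /asboolP; rewrite raddfB.
apply/eqP; rewrite /hclass -Quotient.idealrBE.
by apply/asboolP; exists u; rewrite raddfB.
Qed.

Definition hrepr (x : homology) : cycle := repr x.

Lemma hreprK : cancel hrepr hclass.
Proof. exact: reprK. Qed.

Lemma hclassB : {morph hclass : z z' / z - z'}.
Proof. by move=> z z'; rewrite /hclass [RHS]piE. Qed.

Definition hscale (k : R) (x : homology) : homology := hclass (k *: hrepr x).

Lemma hscaleE k z : hscale k (hclass z) = hclass (k *: z).
Proof.
have /hclassP[u fu] := hreprK (hclass z).
by apply/hclassP; exists (k *: u); rewrite linearZ fu /= scalerBr.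
Qed.

Lemma hclass_ind (P : homology -> Prop) :
  (forall z, P (hclass z)) -> forall x, P x.
Proof. by move=> Pz x; rewrite -(hreprK x). Qed.

HB.instance Definition _ :=
  GRing.isZmodMorphism.Build cycle homology hclass hclassB.

Lemma hscaleA a b x : hscale a (hscale b x) = hscale (a * b) x.
Proof. by elim/hclass_ind: x => z; rewrite !hscaleE scalerA. Qed.

Lemma hscale1 : left_id 1 hscale.
Proof. by elim/hclass_ind => z; rewrite hscaleE scale1r. Qed.

Lemma hscaleDr : right_distributive hscale +%R.
Proof.
move=> a; elim/hclass_ind => x; elim/hclass_ind => y.
by rewrite -raddfD !hscaleE scalerDr raddfD.
Qed.

Lemma hscaleDl x : {morph hscale^~ x : a b / a + b}.
Proof.
by elim/hclass_ind: x => z a b; rewrite !hscaleE scalerDl raddfD.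
Qed.

HB.instance Definition _ := GRing.Zmodule_isLmodule.Build R homology
  hscaleA hscale1 hscaleDr hscaleDl.

Lemma hclassZ : scalable hclass.
Proof. by move=> a z; rewrite -hscaleE. Qed.

HB.instance Definition _ :=
  GRing.isScalable.Build R cycle homology _ hclass hclassZ.

End Homology.
Arguments hclass {R U V W} f {g} z.

Section Bases.
Variables (R : nzRingType) (V : lmodType R).

Definition is_basis n (e : 'I_n -> V) : Prop :=
  (forall c : 'I_n -> R, \sum_i c i *: e i = 0 -> forall i, c i = 0) /\
  (forall v : V, exists c : 'I_n -> R, v = \sum_i c i *: e i).

Definition finite_dim : Prop := exists n (e : 'I_n -> V), is_basis e.

End Bases.

Section Simplices.
Variable R : realType.

Definition std_simplex (q : nat) : set 'rV[R]_q.+1 :=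
  [set t | (forall i, 0 <= t ord0 i) /\ \sum_i t ord0 i = 1].
#[local] Arguments std_simplex q : clear implicits.

(* In barycentric coordinates, the affine map sending vertex i to vertex f i. *)
Definition vertex_row m n (f : 'I_m.+1 -> 'I_n.+1) (t : 'rV[R]_m.+1) :
  'rV[R]_n.+1 := \row_j \sum_(i | f i == j) t ord0 i.

Lemma vertex_row_simplex m n (f : 'I_m.+1 -> 'I_n.+1) t :
  t \in std_simplex m -> vertex_row f t \in std_simplex n.
Proof.
move=> /set_mem[t0 t1]; apply/mem_set; split=> [j|].
  by rewrite mxE sumr_ge0.
by rewrite -t1 (partition_big f xpredT) //=; apply: eq_bigr => j _; rewrite mxE.
Qed.

Definition vertex_map m n (f : 'I_m.+1 -> 'I_n.+1) (t : std_simplex m) :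
  std_simplex n := exist _ (vertex_row f (val t)) (vertex_row_simplex f (valP t)).

Lemma vertex_map_continuous m n (f : 'I_m.+1 -> 'I_n.+1) :
  continuous (vertex_map f).
Proof.
pose f' : std_simplex m -> initial_topology (@set_val _ (std_simplex n)) :=
  vertex_map f.
apply: (@continuous_comp_initial _ _ _ _ f') => t A /= [P P_nbhs PA].
pose G (i : 'I_1 * 'I_n.+1) (s : std_simplex m) :=
  P i.1 i.2 (vertex_row f (val s) i.1 i.2).
suff : \forall s \near t, forall i, G i s.
  by apply: filterS => s Ps; apply: PA => i j; exact: (Ps (i, j)).
have FF : Filter (nbhs t) by exact: nbhs_filter.
apply: (@filter_forall _ _ G (nbhs t) FF) => -[i j]; rewrite /G /= ord1.
have : continuous (fun s : std_simplex m => vertex_row f (val s) ord0 j).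
  under eq_fun do rewrite mxE.
  apply: continuous_big => [|k _]; first exact: add_continuous.
  move=> s; apply: (@continuous_comp _ _ _ (@set_val _ (std_simplex m))
    (fun M : 'rV[R]_m.+1 => M ord0 k)).
    exact: initial_continuous.
  exact: coord_continuous.
move=> /(_ t); apply.
by have := P_nbhs ord0 j; rewrite -[set_val _]/(vertex_row f (val t)).
Qed.

HB.instance Definition _ m n (f : 'I_m.+1 -> 'I_n.+1) :=
  isContinuous.Build (std_simplex m) (std_simplex n) (vertex_map f)
    (@vertex_map_continuous m n f).

Lemma vertex_map_comp l m n (f : 'I_m.+1 -> 'I_n.+1) (g : 'I_l.+1 -> 'I_m.+1) :
  vertex_map f \o vertex_map g = vertex_map (f \o g).
Proof.
apply/funext => t; apply/val_inj/rowP => k /=; rewrite !mxE.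
rewrite (partition_big g (fun j => f j == k)) //=.
apply: eq_bigr => j /eqP fj; rewrite mxE; apply: eq_bigl => i /=.
by case: eqP => [->|]; rewrite ?fj ?eqxx ?andbF.
Qed.

End Simplices.

Arguments std_simplex R q : clear implicits.

Section SingularComplex.
Variables (R : realType) (X : topologicalType).

(* [set_type] carries the subspace topology, so these are the continuous maps
   from the standard q-simplex to X. *)
Definition simplex (q : nat) : Type := continuousType (std_simplex R q) X.
HB.instance Definition _ q := Choice.on (simplex q).

Definition sub_simplex m n (s : simplex n) (f : 'I_m.+1 -> 'I_n.+1) : simplex m :=
  s \o vertex_map f.

Lemma sub_simplex_comp l m n (s : simplex n) (f : 'I_m.+1 -> 'I_n.+1)
    (g : 'I_l.+1 -> 'I_m.+1) :
  sub_simplex (sub_simplex s f) g = sub_simplex s (f \o g).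
Proof. by apply/continuousEP => t /=; rewrite -vertex_map_comp. Qed.

Definition face q (s : simplex q.+1) (i : 'I_q.+2) : simplex q :=
  sub_simplex s (lift i).

Definition chain (q : nat) : Type := {freeg (simplex q) / R}.
HB.instance Definition _ q := GRing.Lmodule.on (chain q).

(* Hom(chain q, R), each homomorphism given by its values on simplices. *)
Definition cochain (q : nat) : Type := simplex q -> R^o.
HB.instance Definition _ q := GRing.Lmodule.on (cochain q).

Definition pairing q (a : cochain q) (c : chain q) : R := fglift a c.

Definition boundary q : chain q.+1 -> chain q :=
  fglift (fun s => \sum_(i < q.+2) (-1) ^+ i *: (<< face s i >> : chain q)).
HB.instance Definition _ q := GRing.Linear.on (@boundary q).

Definition coboundary q (a : cochain q) : cochain q.+1 :=
  fun s => \sum_(i < q.+2) (-1) ^+ i * (a (face s i) : R) : R.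

Lemma coboundary_is_linear q : linear (@coboundary q).
Proof.
move=> k a b; apply/funext => s; rewrite /coboundary.
rewrite -[RHS]/(k * _ + _) mulr_sumr -big_split /=; apply: eq_bigr => i _.
by rewrite -[(k *: a + b) _]/(k * _ + _) mulrDr mulrCA.
Qed.
HB.instance Definition _ q :=
  GRing.isLinear.Build R (cochain q) (cochain q.+1) _ (@coboundary q)
    (@coboundary_is_linear q).

HB.instance Definition _ q (a : cochain q) :=
  GRing.Linear.copy (@pairing q a) (@fglift R R^o _ a).

Lemma pairing1 q (a : cochain q) s : pairing a << s >> = a s.
Proof. by rewrite /pairing liftU scale1r. Qed.

Lemma chain_linear_eq q (M : lmodType R) (f g : {linear chain q -> M}) :
  (forall s, f << s >> = g << s >>) -> f =1 g.
Proof.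
move=> fg c; rewrite -[c]freeg_sumE !linear_sum; apply: eq_bigr => s _.
have -> : (<< coeff s c *g s >> : chain q) = coeff s c *: (<< s >> : chain q).
  by apply/eqP/freeg_eqP => t; rewrite coeffZ !coeffU mul1r.
by rewrite !linearZ_LR fg.
Qed.

Lemma boundary1 q (s : simplex q.+1) :
  boundary << s >> = \sum_(i < q.+2) (-1) ^+ i *: (<< face s i >> : chain q).
Proof. by rewrite /boundary liftU scale1r. Qed.

Lemma pairing_coboundary q (a : cochain q) (c : chain q.+1) :
  pairing (coboundary a) c = pairing a (boundary c).
Proof.
apply: (chain_linear_eq (g := pairing a \o @boundary q)) => s /=.
rewrite pairing1 boundary1 linear_sum; apply: eq_bigr => i _.
by rewrite linearZ /= pairing1.
Qed.

Lemma pairingPl q k (a b : cochain q) c :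
  pairing (k *: a + b) c = k * pairing a c + pairing b c.
Proof.
by apply: (chain_linear_eq (g := k \*: pairing a \+ pairing b)) => s /=;
  rewrite !pairing1.
Qed.

Lemma chain_ext q (c c' : chain q) :
  (forall a : cochain q, pairing a c = pairing a c') -> c = c'.
Proof. by move=> cc'; apply/eqP/freeg_eqP => s; exact: cc'. Qed.

(* The first m + 1 and the last m + 1 of the vertices 0, ..., n. They are meant
   for m <= n, where [inord] does not truncate. *)
Definition front m n (i : 'I_m.+1) : 'I_n.+1 := inord i.
Definition back m n (i : 'I_m.+1) : 'I_n.+1 := inord (n - m + i).

(* These are used with p + q = n. Keeping n separate avoids transporting
   (co)homology classes along equations between degrees.
   The cap product evaluates b on the back face and keeps the front face, so
   that <a, b cap c> = <a cup b, c>; see [pairing_cap]. *)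
Definition cup_cochain p q n (a : cochain p) (b : cochain q) : cochain n :=
  fun s =>
    (a (sub_simplex s (@front p n)) : R) * b (sub_simplex s (@back q n)) : R.

Definition cap_chain p q n (b : cochain q) : chain n -> chain p :=
  fglift (fun s => b (sub_simplex s (@back q n)) *:
                   (<< sub_simplex s (@front p n) >> : chain p)).
HB.instance Definition _ p q n b := GRing.Linear.on (@cap_chain p q n b).

#[global] Arguments cup_cochain {p q} n a b s.
#[global] Arguments cap_chain p {q n} b c.

Lemma pairing_cap p q n (a : cochain p) (b : cochain q) (c : chain n) :
  pairing a (cap_chain p b c) = pairing (cup_cochain n a b) c.
Proof.
apply: (chain_linear_eq (f := pairing a \o cap_chain p b)) => s /=.
by rewrite pairing1 /cap_chain liftU scale1r linearZ /= pairing1; exact: mulrC.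
Qed.

Lemma cup_leibniz p q n (e : (p + q)%N = n) (a : cochain p) (b : cochain q) :
  coboundary (cup_cochain n a b) =
  cup_cochain n.+1 (coboundary a) b +
  (-1) ^+ p *: cup_cochain n.+1 a (coboundary b).
Proof.
apply/funext => s; subst n; rewrite -[RHS]/((_ : R) + (-1) ^+ p * (_ : R)).
pose A i : R := a (sub_simplex s (fun j : 'I_p.+1 => inord (bump i j))).
pose B i : R := b (sub_simplex s (fun j : 'I_q.+1 => inord (bump i (p + j)))).
rewrite /cup_cochain /coboundary.
have E1 : \sum_(i < (p + q).+2) (-1) ^+ i *
    ((a (sub_simplex (face s i) (@front p (p + q))) : R) *
     b (sub_simplex (face s i) (@back q (p + q)))) =
    \sum_(0 <= i < (p + q).+2) (-1) ^+ i * (A i * B i).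
  rewrite big_mkord; apply: eq_bigr => i _; rewrite /A /B.
  congr (_ * (a _ * b _)); rewrite sub_simplex_comp; congr sub_simplex;
    apply/funext => j; apply/val_inj => /=.
    by have jp := ltn_ord j; rewrite /front /bump !inordK; lia.
  by have jq := ltn_ord j; rewrite /back /bump !inordK; lia.
have E2 : \sum_(i < p.+2) (-1) ^+ i *
    (a (face (sub_simplex s (@front p.+1 (p + q).+1)) i) : R) =
    \sum_(0 <= i < p.+2) (-1) ^+ i * A i.
  rewrite big_mkord; apply: eq_bigr => i _; rewrite /A.
  congr (_ * a _); by rewrite /face sub_simplex_comp.
have E3 : \sum_(i < q.+2) (-1) ^+ i *
    (b (face (sub_simplex s (@back q.+1 (p + q).+1)) i) : R) =
    \sum_(0 <= i < q.+2) (-1) ^+ i * B (p + i)%N.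
  rewrite big_mkord; apply: eq_bigr => i _; rewrite /B.
  congr (_ * b _); rewrite /face sub_simplex_comp; congr sub_simplex.
  apply/funext => j; rewrite /= /back /= /bump; congr inord; lia.
rewrite E1 E2 E3.
have A_front i : (p < i)%N -> A i = a (sub_simplex s (@front p (p + q).+1)).
  move=> pi; congr (a (sub_simplex _ _)); apply/funext => j.
  rewrite /front; congr inord; have jp := ltn_ord j; rewrite /bump; lia.
have B_back i : (i <= p)%N -> B i = b (sub_simplex s (@back q (p + q).+1)).
  move=> pi; congr (b (sub_simplex _ _)); apply/funext => j.
  rewrite /back; congr inord; rewrite /bump; lia.
rewrite (@big_cat_nat _ _ _ p.+1) //=; last by lia.
rewrite [X in X * _ + _]big_nat_recr //= [X in _ + _ * (_ * X)]big_nat_recl //=.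
rewrite A_front // addn0 B_back // expr0 mul1r mulrDl exprS.
set x : R := a _; set y : R := b _.
have -> : \sum_(0 <= i < p.+1) (-1) ^+ i * (A i * B i) =
    (\sum_(0 <= i < p.+1) (-1) ^+ i * A i) * y.
  rewrite mulr_suml !big_nat; apply: eq_bigr => i /andP[_ ip].
  by rewrite B_back // mulrA.
have -> : \sum_(p.+1 <= i < (p + q).+2) (-1) ^+ i * (A i * B i) =
    (-1) ^+ p * (x * \sum_(0 <= i < q.+1) (-1) ^+ i.+1 * B (p + i.+1)%N).
  rewrite -{1}[p.+1]add0n big_addn !mulr_sumr.
  have -> : ((p + q).+2 - p.+1 = q.+1)%N by lia.
  apply: eq_bigr => i _; rewrite A_front; last by lia.
  have -> : (i + p.+1 = p + i.+1)%N by lia.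
  by rewrite exprD !exprS -/x; ring.
by rewrite /=; ring.
Qed.

Lemma cap_leibniz p q n (e : (p + q)%N = n) (b : cochain q) (c : chain n.+1) :
  boundary (cap_chain p.+1 b c) =
  cap_chain p b (boundary c) + (-1) ^+ p.+1 *: cap_chain p (coboundary b) c.
Proof.
apply: chain_ext => a; rewrite -pairing_coboundary linearD linearZ /= !pairing_cap.
rewrite -pairing_coboundary (cup_leibniz e).
have pairingDP (u v : cochain n.+1) k :
    pairing (u + k *: v) c = pairing u c + k * pairing v c.
  by rewrite addrC pairingPl addrC.
by rewrite pairingDP exprS -[X in _ + X]/(_ * (_ : R)); ring.
Qed.

(* The boundary leaving degree q and the coboundary entering degree q; both are
   zero for q = 0. *)
Definition boundary_out q : {linear chain q -> chain q.-1} :=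
  match q with
  | 0 => @GRing.null_fun (chain 0) (chain 0)
  | q'.+1 => @boundary q'
  end.

Definition coboundary_in q : {linear cochain q.-1 -> cochain q} :=
  match q with
  | 0 => @GRing.null_fun (cochain 0) (cochain 0)
  | q'.+1 => @coboundary q'
  end.

Definition sing_homology q : lmodType R :=
  homology (@boundary q) (boundary_out q).

Definition sing_cohomology q : lmodType R :=
  homology (coboundary_in q) (@coboundary q).

Lemma pairingBl q (a b : cochain q) c :
  pairing (a - b) c = pairing a c - pairing b c.
Proof. by rewrite addrC -scaleN1r pairingPl mulN1r addrC. Qed.

Lemma pairing0l q (c : chain q) : pairing (0 : cochain q) c = 0.
Proof. by rewrite -(subrr (0 : cochain q)) pairingBl subrr. Qed.

Lemma pairing_coboundary_in q (a : cochain q.-1) (c : chain q) :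
  pairing (coboundary_in q a) c = pairing a (boundary_out q c).
Proof.
case: q a c => [|q] a c /=; last exact: pairing_coboundary.
by rewrite linear0; exact: pairing0l.
Qed.

Local Notation cocycle q := (cycle (@coboundary q)).
Local Notation hcycle q := (cycle (boundary_out q)).

Lemma cocycleP q (a : cocycle q) : coboundary (val a) = 0.
Proof. exact/eqP/(valP a). Qed.

Lemma hcycleP q (z : hcycle q) : boundary_out q (val z) = 0.
Proof. exact/eqP/(valP z). Qed.

(* Kronecker, cup and cap products of classes are computed on chosen
   representatives; the lemmas [kronecker_hclass], [cup_hclass] and [cap_hclass]
   show that the choice is irrelevant. *)
Definition kronecker q (a : sing_cohomology q) (x : sing_homology q) : R :=
  pairing (val (hrepr a)) (val (hrepr x)).

Lemma kronecker_hclass q (a : cocycle q) (z : hcycle q) :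
  kronecker (hclass _ a) (hclass _ z) = pairing (val a) (val z).
Proof.
rewrite /kronecker.
have /hclassP[u fu] := hreprK (hclass (coboundary_in q) a).
have /hclassP[v fv] := hreprK (hclass (@boundary q) z).
set a' := val (hrepr _) in fu *; set z' := val (hrepr _) in fv *.
have -> : pairing a' z' = pairing (val a) z'.
  apply/eqP; rewrite -subr_eq0 -pairingBl -fu pairing_coboundary_in.
  by rewrite hcycleP linear0.
apply/eqP; rewrite -subr_eq0 -linearB /= -fv -pairing_coboundary cocycleP.
by rewrite pairing0l.
Qed.

Lemma cup_cochainBl p q n (a a' : cochain p) (b : cochain q) :
  cup_cochain n (a - a') b = cup_cochain n a b - cup_cochain n a' b.
Proof. by apply/funext => s; exact: mulrBl. Qed.

Lemma cup_cochainBr p q n (a : cochain p) (b b' : cochain q) :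
  cup_cochain n a (b - b') = cup_cochain n a b - cup_cochain n a b'.
Proof. by apply/funext => s; exact: mulrBr. Qed.

Lemma cup_cochain0l p q n (b : cochain q) :
  cup_cochain n (0 : cochain p) b = 0.
Proof. by apply/funext => s; exact: mul0r. Qed.

Lemma cup_cochain0r p q n (a : cochain p) :
  cup_cochain n a (0 : cochain q) = 0.
Proof. by apply/funext => s; exact: mulr0. Qed.

Lemma cup_cocycle_subproof p q n (e : (p + q)%N = n) (a : cocycle p)
    (b : cocycle q) :
  cup_cochain n (val a) (val b) \in ker_pred (@coboundary n).
Proof.
by rewrite inE /= (cup_leibniz e) !cocycleP cup_cochain0l cup_cochain0r scaler0 addr0.
Qed.

Definition cup_cocycle p q n (e : (p + q)%N = n) (a : cocycle p) (b : cocycle q) :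
  cocycle n := Sub (cup_cochain n (val a) (val b)) (cup_cocycle_subproof e a b).

Definition cup p q n (e : (p + q)%N = n) (a : sing_cohomology p)
    (b : sing_cohomology q) : sing_cohomology n :=
  hclass _ (cup_cocycle e (hrepr a) (hrepr b)).

Lemma cup_hclass p q n (e : (p + q)%N = n) (a : cocycle p) (b : cocycle q) :
  cup e (hclass _ a) (hclass _ b) = hclass _ (cup_cocycle e a b).
Proof.
rewrite /cup.
have /hclassP[u fu] := hreprK (hclass (coboundary_in p) a).
have /hclassP[v fv] := hreprK (hclass (coboundary_in q) b).
set a' := hrepr _ in fu *; set b' := hrepr _ in fv *.
transitivity (hclass (coboundary_in n) (cup_cocycle e a b')); apply/hclassP => /=.
- rewrite -cup_cochainBl -fu; case: p e a u a' fu => [|p] e a u a' fu /=.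
    by exists 0; rewrite cup_cochain0l linear0.
  case: n e => [|n] // e; have e' : (p + q)%N = n by case: e.
  exists (cup_cochain n u (val b')).
  by rewrite /= (cup_leibniz e') cocycleP cup_cochain0r scaler0 addr0.
- rewrite -cup_cochainBr -fv; case: q e b v b' fv => [|q] e b v b' fv /=.
    by exists 0; rewrite cup_cochain0r linear0.
  rewrite addnS in e; case: n e => [|n] // e; have e' : (p + q)%N = n by case: e.
  exists ((-1) ^+ p *: cup_cochain n (val a) v).
  rewrite /= linearZ /= (cup_leibniz e') cocycleP cup_cochain0l add0r.
  by rewrite scalerA -signr_odd -expr2 sqrr_sign scale1r.
Qed.

Lemma cap_chainBl p q n (b b' : cochain q) (c : chain n) :
  cap_chain p (b - b') c = cap_chain p b c - cap_chain p b' c.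
Proof.
apply: chain_ext => a; rewrite linearB /= !pairing_cap -pairingBl.
by rewrite cup_cochainBr.
Qed.

Lemma cap_chain0l p q n (c : chain n) : cap_chain p (0 : cochain q) c = 0.
Proof. by rewrite -(subrr (0 : cochain q)) cap_chainBl subrr. Qed.

Lemma cap_cycle_subproof p q n (e : (p + q)%N = n) (b : cocycle q)
    (z : hcycle n) :
  cap_chain p (val b) (val z) \in ker_pred (@boundary_out p).
Proof.
rewrite inE; case: p e => [|p] e //=.
case: n e z => [|n] // e z; have e' : (p + q)%N = n by case: e.
have z0 : boundary (val z) = 0 := hcycleP z.
by rewrite (cap_leibniz e') z0 cocycleP cap_chain0l linear0 scaler0 addr0.
Qed.

Definition cap_cycle p q n (e : (p + q)%N = n) (b : cocycle q) (z : hcycle n) :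
  hcycle p := Sub (cap_chain p (val b) (val z)) (cap_cycle_subproof e b z).

Definition cap p q n (e : (p + q)%N = n) (b : sing_cohomology q)
    (x : sing_homology n) : sing_homology p :=
  hclass _ (cap_cycle e (hrepr b) (hrepr x)).

Lemma cap_hclass p q n (e : (p + q)%N = n) (b : cocycle q) (z : hcycle n) :
  cap e (hclass _ b) (hclass _ z) = hclass _ (cap_cycle e b z).
Proof.
rewrite /cap.
have /hclassP[u fu] := hreprK (hclass (coboundary_in q) b).
have /hclassP[v fv] := hreprK (hclass (@boundary n) z).
set b' := hrepr _ in fu *; set z' := hrepr _ in fv *.
transitivity (hclass (@boundary p) (cap_cycle e b z')); apply/hclassP => /=.
- rewrite -cap_chainBl -fu; case: q e b u b' fu => [|q] e b u b' fu /=.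
    by exists 0; rewrite cap_chain0l linear0.
  rewrite addnS in e; case: n e z v z' fv => [|n] // e z v z' fv.
  have e' : (p + q)%N = n by case: e.
  have z0 : boundary (val z') = 0 := hcycleP z'.
  exists ((-1) ^+ p.+1 *: cap_chain p.+1 u (val z')).
  rewrite linearZ /= (cap_leibniz e') z0 linear0 add0r.
  by rewrite scalerA -signr_odd -expr2 sqrr_sign scale1r.
- rewrite -linearB -fv; exists (cap_chain p.+1 (val b) v).
  by rewrite (cap_leibniz e) cocycleP cap_chain0l scaler0 addr0.
Qed.

Lemma kronecker_cap p q n (e : (p + q)%N = n) (a : sing_cohomology p)
    (b : sing_cohomology q) (x : sing_homology n) :
  kronecker a (cap e b x) = kronecker (cup e a b) x.
Proof.
rewrite -(hreprK a) -(hreprK b) -(hreprK x) cap_hclass cup_hclass.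
by rewrite !kronecker_hclass /= pairing_cap.
Qed.

Lemma cap_is_linear p q n (e : (p + q)%N = n) (x : sing_homology n) :
  linear (fun b : sing_cohomology q => cap e b x).
Proof.
move=> k b b'; rewrite -(hreprK b) -(hreprK b') -(hreprK x).
rewrite -linearP !cap_hclass -linearP; congr hclass; apply/val_inj => /=.
apply: chain_ext => a; rewrite linearP /= !pairing_cap.
rewrite -[RHS]/(k * _ + _) -pairingPl; congr pairing; apply/funext => s.
rewrite -[LHS]/(_ * (k * _ + _)) -[RHS]/(k * (_ * _) + _ * _).
by rewrite mulrDr mulrCA.
Qed.

(* X is a connected Poincare duality space of dimension m with class x. The
   graded space of cohomology is finite dimensional when each degree is and all
   but finitely many degrees vanish. Capping with x maps degree q to degree
   m - q, and homology is zero in negative degrees: hence the last clause. *)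
Record poincare_duality_space m (x : sing_homology m) : Prop := {
  pd_connected : connected [set: X];
  pd_finite_dim : forall q, finite_dim (sing_cohomology q);
  pd_bounded : exists N, forall q, (N < q)%N ->
    forall b : sing_cohomology q, b = 0;
  pd_iso : forall p q (e : (p + q)%N = m),
    bijective (fun b : sing_cohomology q => cap e b x);
  pd_iso_above : forall q, (m < q)%N -> forall b : sing_cohomology q, b = 0
}.

End SingularComplex.
Arguments sing_homology R X q : clear implicits.
Arguments sing_cohomology R X q : clear implicits.

Lemma middle_degree (d : nat) : (2 * d + 2 * d = 4 * d)%N.
Proof. by rewrite -mulnDl. Qed.

(* Main.v *)
(* Capping with [X] is injective, and the Kronecker pairing reads off coordinates
   in the basis alpha, so alpha_j^* cap [X] = sum_k A_kj alpha_k gives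
   alpha_j^* = sum_k A_kj alpha_k^vee. Pairing with alpha_i = alpha_i^vee cap [X]
   yields A^T B = 1. It remains to see that A is symmetric, i.e. that the cup
   product is graded commutative. Reversing the order of the vertices, with sign
   (-1)^(n(n+1)/2), exchanges the two factors of a cup product and is chain
   homotopic to the identity. The homotopy only involves simplices spanned by
   vertices of a given simplex, so it is constructed on functions of sequences of
   vertices. *)
From HB Require Import structures.
Require Import Defs.
From mathcomp Require Import all_boot all_order all_algebra.
From mathcomp Require Import boolp reals topology.
From mathcomp Require Import zify ring.

Set Implicit Arguments.
Unset Strict Implicit.
Unset Printing Implicit Defensive.

Import GRing.Theory.
Local Open Scope ring_scope.

(** * Reversal of vertex sequences and its homotopy to the identity *)

Section ReversalHomotopy.
Variables (R : comNzRingType) (T : Type).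
Implicit Types (f g : seq T -> R) (l : seq T) (x : T).

Definition omit l i := take i l ++ drop i.+1 l.

(** This complex is augmented: a one-vertex sequence has the empty sequence as a face, so inductions
    can start at the empty sequence. *)
Definition seq_coboundary f l : R := \sum_(i < size l) (-1) ^+ i * f (omit l i).

(** The sign of the permutation reversing [n] letters; [n] counts vertices, so it is the dimension
    plus one. *)
Definition rev_sign (n : nat) : R := (-1) ^+ 'C(n, 2).

Definition reversal f l : R := rev_sign (size l) * f (rev l).

(* Dual to the operator P on ordered simplices with P (x l) = x R(x l) - x P(l),
   where R is the signed reversal and x l the cone on l with apex x; unfolding
   the recursion gives the sum of the terms +- [v_0 .. v_i, v_n .. v_i]. *)
Fixpoint prism f l : R :=
  if l is x :: l' then reversal (f \o cons x) l - prism (f \o cons x) l' else 0.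

Lemma size_omit l i : (i < size l)%N -> size (omit l i) = (size l).-1.
Proof. by move=> il; rewrite size_cat size_take size_drop il; lia. Qed.

Lemma nth_omit x l i j : (i < size l)%N -> nth x (omit l i) j = nth x l (bump i j).
Proof.
move=> il; rewrite nth_cat size_take il /bump [(i <= j)%N]leqNgt.
by case: ltnP => ij; [rewrite nth_take | rewrite nth_drop; congr nth; rewrite /=; lia].
Qed.

Lemma seq_coboundary_cons f x l :
  seq_coboundary f (x :: l) = f l - seq_coboundary (f \o cons x) l.
Proof.
rewrite /seq_coboundary big_ord_recl /omit /= drop0 expr0 mul1r -sumrN.
by congr (_ + _); apply: eq_bigr => i _; rewrite /= /bump add1n exprS mulN1r mulNr.
Qed.

Lemma seq_coboundary_rcons f l x :
  seq_coboundary f (rcons l x) =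
  seq_coboundary (fun u => f (rcons u x)) l + (-1) ^+ size l * f l.
Proof.
rewrite /seq_coboundary size_rcons big_ord_recr /= /omit; congr (_ + _ * f _).
  apply: eq_bigr => i _; congr (_ * f _).
  by rewrite drop_rcons // -rcons_cat -[rcons l x]cats1 takel_cat // ltnW.
by rewrite drop_oversize ?size_rcons // cats0 -cats1 take_size_cat.
Qed.

Lemma seq_coboundaryB f g l :
  seq_coboundary (fun u => f u - g u) l = seq_coboundary f l - seq_coboundary g l.
Proof. by rewrite -sumrB; apply: eq_bigr => i _; rewrite mulrBr. Qed.

Lemma rev_signS n : rev_sign n.+1 = (-1) ^+ n * rev_sign n.
Proof. by rewrite /rev_sign binS bin1 addnC exprD. Qed.

(** C(p+q+1, 2) = C(p+1, 2) + C(q+1, 2) + pq. This is the source of the sign in graded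
    commutativity. *)
Lemma rev_signD p q :
  rev_sign (p + q).+1 = (-1) ^+ (p * q) * (rev_sign p.+1 * rev_sign q.+1).
Proof.
elim: q => [|q IHq]; first by rewrite addn0 muln0 mul1r [rev_sign 1]expr0 mulr1.
by rewrite addnS rev_signS IHq [rev_sign q.+2]rev_signS mulnS -!addnS !exprD; ring.
Qed.

Lemma reversalB f g l :
  reversal (fun u => f u - g u) l = reversal f l - reversal g l.
Proof. exact: mulrBr. Qed.

(** In a sequence of n+1 vertices, reversal turns omission at i into omission at n-i; the resulting
    sign (-1)^n is the ratio of [rev_sign n.+1] to [rev_sign n]. *)
Lemma seq_coboundary_reversal f l :
  seq_coboundary (reversal f) l = reversal (seq_coboundary f) l.
Proof.
elim: l f => [|x l IHl] f.
  by rewrite /reversal /seq_coboundary !big_ord0 mulr0.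
rewrite seq_coboundary_cons [in RHS]/reversal rev_cons seq_coboundary_rcons size_rev.
have -> : seq_coboundary (reversal f \o cons x) l =
    - (-1) ^+ size l * seq_coboundary (reversal (fun u => f (rcons u x))) l.
  rewrite [in RHS]/seq_coboundary mulr_sumr; apply: eq_bigr => i _.
  rewrite /reversal /= rev_cons rev_signS size_omit //.
  have -> : (-1) ^+ size l = - (-1) ^+ (size l).-1 :> R.
    by rewrite -{1}(ltn_predK (ltn_ord i)) exprS mulN1r.
  by ring.
rewrite IHl /reversal /= rev_signS.
have := sqrr_sign R (size l); rewrite expr2 => sgn2.
by rewrite mulrDr [_ * (_ * f _)]mulrACA sgn2 mul1r addrC mulNr opprK mulrA.
Qed.

Lemma prismB f g l : prism (fun u => f u - g u) l = prism f l - prism g l.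
Proof.
elim: l f g => [|x l IHl] f g /=; first by rewrite subr0.
have -> : (fun u => f u - g u) \o cons x =
  fun u => (f \o cons x) u - (g \o cons x) u by [].
by rewrite IHl reversalB; ring.
Qed.

Lemma prism0 l : prism (fun=> 0) l = 0.
Proof.
elim: l => //= x l IHl.
by rewrite [prism _ l]IHl /reversal /= mulr0 subr0.
Qed.

Lemma prism_homotopy f l :
  prism (seq_coboundary f) l + seq_coboundary (prism f) l = reversal f l - f l.
Proof.
elim: l f => [|x l IHl] f.
  by rewrite /= /seq_coboundary big_ord0 /reversal /= mul1r subrr addr0.
set g := f \o cons x.
have coboundary_cons :
    seq_coboundary f \o cons x = fun u => f u - seq_coboundary g u.
  by apply/funext => u; exact: seq_coboundary_cons.
have prism_cons :
    prism f \o cons x = fun u => (reversal g \o cons x) u - prism g u by [].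
rewrite seq_coboundary_cons prism_cons seq_coboundaryB /= coboundary_cons.
rewrite reversalB prismB -seq_coboundary_reversal seq_coboundary_cons.
(* The induction hypothesis for [g], solved for [g l], which is [f (x :: l)]; all remaining terms
   cancel. *)
have -> : f (x :: l) =
    reversal g l - (prism (seq_coboundary g) l + seq_coboundary (prism g) l).
  by rewrite IHl subKr.
by ring.
Qed.

End ReversalHomotopy.

Lemma prism_map (R : comNzRingType) (S T : Type) (h : S -> T) (f : seq T -> R) l :
  prism f (map h l) = prism (f \o map h) l.
Proof.
by elim: l f => //= x l IHl f; rewrite IHl /reversal /= size_map -map_cons map_rev.
Qed.

(** * Graded commutativity of the cup product *)

Section CupCommutativity.
Variables (R : realType) (X : topologicalType).

Local Notation cocycle q := (Defs.cycle (@coboundary R X q)).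

(** The value 0 on sequences of the wrong length makes this pullback commute with coboundaries in
    every length. Vertices may repeat, as they do in the prism. *)
Definition on_vertices m n (c : cochain R X n) (s : simplex R X m)
    (l : seq 'I_m.+1) : R :=
  if size l == n.+1 then c (sub_simplex s (fun i : 'I_n.+1 => nth ord0 l i)) else 0.

Definition reversed n (c : cochain R X n) : cochain R X n :=
  fun s => rev_sign R n.+1 * (c (sub_simplex s (@rev_ord n.+1)) : R) : R.

Lemma on_vertices_enum n (c : cochain R X n) s :
  on_vertices c s (enum 'I_n.+1) = c s.
Proof.
rewrite /on_vertices size_enum_ord eqxx; congr c.
rewrite (_ : (fun i => _) = id); last by apply/funext => i; exact: nth_ord_enum.
apply/continuousEP => t; rewrite /sub_simplex /=; congr (s _).
apply/val_inj/rowP => i; rewrite mxE (bigD1 i) //= big1 ?addr0 // => j.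
by case/andP=> /eqP->; rewrite eqxx.
Qed.

Lemma on_vertices_reversed m n (c : cochain R X n) (s : simplex R X m) :
  on_vertices (reversed c) s = reversal (on_vertices c s).
Proof.
apply/funext => l; rewrite /reversal /on_vertices size_rev.
case: eqP => [ln|_]; last by rewrite mulr0.
rewrite /reversed ln sub_simplex_comp; congr (_ * c _).
congr sub_simplex; apply/funext => i.
by rewrite /= nth_rev ln.
Qed.

Lemma on_vertices_face m n (c : cochain R X n) (s : simplex R X m.+1) i :
  on_vertices c (face s i) = on_vertices c s \o map (lift i).
Proof.
apply/funext => l; rewrite /on_vertices /= size_map; case: eqP => // ln.
congr c; rewrite /face sub_simplex_comp; congr sub_simplex; apply/funext => j.
by rewrite /= (nth_map ord0) // ln.
Qed.

Lemma seq_coboundary_on_vertices m n (c : cochain R X n) (s : simplex R X m) :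
  seq_coboundary (on_vertices c s) = on_vertices (coboundary c) s.
Proof.
apply/funext => l; rewrite {2}/on_vertices; case: eqP => ln.
  rewrite /seq_coboundary ln; apply: eq_bigr => i _; congr (_ * _).
  rewrite /on_vertices size_omit ln // eqxx /face sub_simplex_comp; congr c.
  by congr sub_simplex; apply/funext => j; rewrite nth_omit ?ln.
rewrite /seq_coboundary big1 // => i _; rewrite /on_vertices size_omit //.
by case: eqP; rewrite ?mulr0 //; have := ltn_ord i; lia.
Qed.

Lemma omit_enum n (i : 'I_n.+2) : omit (enum 'I_n.+2) i = map (lift i) (enum 'I_n.+1).
Proof.
apply: (@eq_from_nth _ ord0) => [|j].
  by rewrite [RHS]size_map size_omit !size_enum_ord.
rewrite size_omit ?size_enum_ord //= => jn.
rewrite nth_omit ?size_enum_ord // (nth_map ord0) ?size_enum_ord //.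
apply/val_inj; rewrite /= !nth_enum_ord //.
by have := ltn_ord i; rewrite /bump; lia.
Qed.

Lemma coboundary_reversed n (c : cochain R X n) :
  coboundary (reversed c) = reversed (coboundary c).
Proof.
apply/funext => s; rewrite -[LHS]on_vertices_enum -[RHS]on_vertices_enum.
rewrite -seq_coboundary_on_vertices !on_vertices_reversed.
by rewrite -seq_coboundary_on_vertices seq_coboundary_reversal.
Qed.

Lemma reversed_cohomologous n (c : cochain R X n) :
  coboundary c = 0 -> exists u, coboundary_in R X n u = reversed c - c.
Proof.
(* The prism on the n'+1 vertices of [t] repeats one of them, so [c] is evaluated on n'+2 = n+1
   vertices. *)
move=> c0; exists (match n return cochain R X n -> cochain R X n.-1 with
  | 0 => fun=> 0
  | n'.+1 => fun c => fun t => prism (on_vertices c t) (enum 'I_n'.+1)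
  end c).
apply/funext => s; rewrite -[RHS]/((_ : R) - (_ : R)).
rewrite -[reversed c s]on_vertices_enum -[c s]on_vertices_enum.
rewrite on_vertices_reversed -prism_homotopy.
rewrite seq_coboundary_on_vertices c0.
rewrite (_ : on_vertices _ s = fun=> 0); last first.
  by apply/funext => l; rewrite /on_vertices if_same.
rewrite prism0 add0r; case: n c {c0} s => [|n] c s.
  (* In degree 0 the only face is the empty sequence, where [prism] vanishes. *)
  case: (enum 'I_1) (size_enum_ord 1) => [|x []] // _.
  by rewrite /seq_coboundary big_ord1 /= mulr0.
rewrite /= /coboundary /seq_coboundary size_enum_ord; apply: eq_bigr => i _.
(* By naturality, the prism on face [i] is the prism on the vertices of [s] other than [i]. *)
by rewrite on_vertices_face omit_enum prism_map.
Qed.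

(** Reversing all vertices turns the front face into the reversed back face and vice versa;
    [rev_signD] compares the signs. *)
Lemma reversed_cup p q n (e : (p + q)%N = n) (a : cochain R X p) (b : cochain R X q) :
  reversed (cup_cochain n a b) =
  (-1) ^+ (p * q) *: cup_cochain n (reversed b) (reversed a).
Proof.
subst n; apply/funext => s; rewrite -[RHS]/(_ * (_ * (_ : R) * (_ * (_ : R)))).
rewrite /reversed /cup_cochain !sub_simplex_comp rev_signD.
set a1 : R := a _; set b1 : R := b _; set b2 : R := b _; set a2 : R := a _.
have -> : a1 = a2.
  congr (a (sub_simplex _ _)); apply/funext => i; apply/val_inj => /=.
  by have li := ltn_ord i; rewrite /front /back !inordK; rewrite /=; lia.
have -> : b1 = b2.
  congr (b (sub_simplex _ _)); apply/funext => i; apply/val_inj => /=.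
  by have li := ltn_ord i; rewrite /front /back !inordK; rewrite /=; lia.
by ring.
Qed.

Lemma reversed_cocycle_subproof n (c : cocycle n) :
  reversed (val c) \in ker_pred (@coboundary R X n).
Proof.
have reversed0 : reversed (0 : cochain R X n.+1) = 0.
  by apply/funext => s; exact: mulr0.
by rewrite inE /= coboundary_reversed cocycleP reversed0.
Qed.

Definition reversed_cocycle n (c : cocycle n) :
  cocycle n := Sub (reversed (val c)) (reversed_cocycle_subproof c).

Lemma hclass_reversed n (c : cocycle n) :
  hclass (coboundary_in R X n) (reversed_cocycle c) = hclass _ c.
Proof. by apply/hclassP; apply: reversed_cohomologous; exact: cocycleP. Qed.

Theorem cup_comm p q n (e : (p + q)%N = n) (e' : (q + p)%N = n)
    (a : sing_cohomology R X p) (b : sing_cohomology R X q) :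
  cup e a b = (-1) ^+ (p * q) *: cup e' b a.
Proof.
(* Reversal fixes classes, so it may be applied to the product on the left and to each factor on the
   right. *)
rewrite -(hreprK a) -(hreprK b) cup_hclass -hclass_reversed.
rewrite -[in RHS]hclass_reversed -[in X in cup e' _ X]hclass_reversed cup_hclass.
rewrite -linearZ; congr hclass; apply/val_inj; exact: reversed_cup.
Qed.

End CupCommutativity.

(** * Coordinates in the dual bases and the inverse matrix *)

Lemma linear_comb (R : nzRingType) (U V : lmodType R) (f : U -> V) n
    (c : 'I_n -> R) (u : 'I_n -> U) :
  linear f -> f (\sum_i c i *: u i) = \sum_i c i *: f (u i).
Proof.
move=> f_lin; pose g : {linear U -> V} :=
  HB.pack f (GRing.isLinear.Build R U V _ f f_lin).
by rewrite -[f]/(g : U -> V) linear_sum; apply: eq_bigr => i _; rewrite linearZ.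
Qed.

Lemma kronecker_suml (R : realType) (X : topologicalType) q n (c : 'I_n -> R)
    (a : 'I_n -> sing_cohomology R X q) (x : sing_homology R X q) :
  kronecker (\sum_i c i *: a i) x = \sum_i c i * kronecker (a i) x.
Proof.
apply: (@linear_comb R _ R^o (fun b => kronecker b x)) => k {}a b.
rewrite -(hreprK a) -(hreprK b) -(hreprK x) -linearP !kronecker_hclass.
exact: pairingPl.
Qed.

Lemma kronecker_sumr (R : realType) (X : topologicalType) q n (c : 'I_n -> R)
    (a : sing_cohomology R X q) (x : 'I_n -> sing_homology R X q) :
  kronecker a (\sum_i c i *: x i) = \sum_i c i * kronecker a (x i).
Proof.
apply: (@linear_comb R _ R^o (kronecker a)) => k {}x y.
by rewrite -(hreprK a) -(hreprK x) -(hreprK y) -linearP !kronecker_hclass linearP.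
Qed.

Theorem lemma4p1 (R : realType) (X : topologicalType) (d : nat)
    (fX : sing_homology R X (4 * d)) (hX : poincare_duality_space fX)
    (n : nat) (alpha : 'I_n -> sing_homology R X (2 * d))
    (alpha_basis : is_basis alpha)
    (alpha_star alpha_vee : 'I_n -> sing_cohomology R X (2 * d))
    (kronecker_dual : forall i j,
       kronecker (alpha_star i) (alpha j) = (i == j)%:R)
    (poincare_dual : forall i,
       cap (middle_degree d) (alpha_vee i) fX = alpha i) :
  let A : 'M[R]_n := \matrix_(i, j)
    kronecker (cup (middle_degree d) (alpha_star i) (alpha_star j)) fX in
  let B : 'M[R]_n := \matrix_(i, j)
    kronecker (cup (middle_degree d) (alpha_vee i) (alpha_vee j)) fX in
  [/\ A^T = A, B^T = B, A \in unitmx & invmx A = B].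
Proof.
move=> A B.
have A_sym : A^T = A.
  apply/matrixP => i j; rewrite !mxE (cup_comm _ (middle_degree d)).
  (* The exponent 2d * 2d of the sign is even. *)
  by rewrite -signr_odd !oddM expr0 scale1r.
have star_vee j : alpha_star j = \sum_k A k j *: alpha_vee k.
  have [capV capK _] := pd_iso hX (middle_degree d); apply: (can_inj capK).
  rewrite (linear_comb _ _ (cap_is_linear (middle_degree d) fX)).
  have [c cap_star] := alpha_basis.2 (cap (middle_degree d) (alpha_star j) fX).
  rewrite cap_star; apply: eq_bigr => k _; rewrite poincare_dual; congr (_ *: _).
  rewrite mxE -kronecker_cap cap_star kronecker_sumr (bigD1 k) //=.
  rewrite kronecker_dual eqxx mulr1 big1 ?addr0 // => i /negPf ik.
  by rewrite kronecker_dual eq_sym ik mulr0.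
have AB1 : A *m B = 1%:M.
  apply/matrixP => j i; rewrite !mxE -kronecker_dual star_vee kronecker_suml.
  (* The expansion of [alpha_star j] has coefficients [A k j], the matrix product [A j k]: symmetry
     of [A] reconciles them. *)
  apply: eq_bigr => k _; congr (_ * _); first by rewrite -[in LHS]A_sym mxE.
  by rewrite mxE -kronecker_cap poincare_dual.
have [A_unit _] := mulmx1_unit AB1.
have invA : invmx A = B by rewrite -[B](mulKmx A_unit) AB1 mulmx1.
(* [B] is symmetric as the inverse of a symmetric matrix. *)
by split=> //; rewrite -invA trmx_inv A_sym.
Qed.
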